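(* Let $(a_n)$ be an arithmetic sequence and let $(d_n)$ be the associated non-arithmetic sequence. If $(a_n)$ is strongly non dli, then $t^{s}_{(d_n)}(\mathbb{T})=t_{(d_n)}(\mathbb{T})$.
   Context: $\mathbb{N}=\{1,2,3,\dots\}$ and $\mathbb{T}=\mathbb{R}/\mathbb{Z}$ is the circle group. For $A\subseteq\mathbb{N}$, $\overline{d}(A)=\limsup_{n\to\infty}\frac{|A\cap[0,n-1]|}{n}$ is the upper natural density, $\underline{d}(A)$ is the corresponding liminf, and $d(A)$ denotes the common value when they agree. An arithmetic sequence is a sequence of positive integers $(a_n)_{n\ge 0}$ with $1=a_0<a_1<a_2<\dots$ and $a_n\mid a_{n+1}$ for every $n$. Its ratios are $b_n=a_n/a_{n-1}$ for $n\ge1$ (so $b_1=a_1$ and $b_n\ge 2$). The associated sequence $(d_n)_{n\ge1}$ is the increasing enumeration of the set $\{r a_k : k\ge 0,\ 1\le r<b_{k+1}\}$. Write $a_k=d_{n_k}$; thus $n_0=1$, $n_{k+1}-n_k=b_{k+1}-1$, and $d_{n_k+r-1}=ra_k$ for $1\le r\le b_{k+1}-1$. The lifting function $L:\mathcal{P}(\mathbb{N})\to\mathcal{P}(\mathbb{N})$ is $L(A)=\bigcup_{k\in A}[n_{k-1},n_k-1]$ (integer intervals). $(a_n)$ is strongly non dli (strongly non density lifting invariant) if $\overline{d}(L(A))>0$ for every infinite $A\subseteq\mathbb{N}$. For a sequence of integers $(u_n)$, $t_{(u_n)}(\mathbb{T})=\{x\in\mathbb{T}: u_nx\to 0 \text{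 in }\mathbb{T}\}$ and $t^s_{(u_n)}(\mathbb{T})=\{x\in\mathbb{T}: u_nx\to 0\text{ statistically in }\mathbb{T}\}$, where the latter means that for every $\varepsilon>0$, $d(\{n\in\mathbb{N}:\|u_nx\|\ge\varepsilon\})=0$, with $\|y\|$ the distance from $y$ to the nearest integer. *)

(* Defs.v *)
From HB Require Import structures.
From mathcomp Require Import all_boot all_order all_algebra.
From mathcomp Require Import ring_quotient.
From mathcomp Require Import zify ring.
From mathcomp Require Import all_classical all_reals all_analysis.

Set Implicit Arguments.
Unset Strict Implicit.
Unset Printing Implicit Defensive.

Import Order.TTheory GRing.Theory Num.Theory.
Import numFieldNormedType.Exports.

Local Open Scope classical_set_scope.
Local Open Scope ring_scope.

(* N = {1, 2, 3, ...}. Sequences indexed by N are functions on nat whose value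
   at 0 is never used. *)
Definition posnat : set nat := [set n | (0 < n)%N].

Section Density.
Variable R : realType.
Implicit Type A : set nat.

(* The value at n = 0 is 0 and has no influence on the limits. *)
Definition frequency A (n : nat) : \bar R :=
  (#|[pred i : 'I_n | (i : nat) \in A]|%:R / n%:R)%:E.

Definition upper_density A : \bar R := limn_esup (frequency A).
Definition lower_density A : \bar R := limn_einf (frequency A).

Definition has_density A (l : \bar R) : Prop :=
  upper_density A = l /\ lower_density A = l.

End Density.

Section ArithmeticSequences.
Local Open Scope nat_scope.
Implicit Types (a d : nat -> nat) (A S : set nat).

Definition arithmetic_sequence a : Prop :=
  [/\ a 0 = 1, forall n, a n < a n.+1 & forall n, a n %| a n.+1].

(* b_n, meaningful for n >= 1. *)
Definition ratio a (n : nat) : nat := a n %/ a n.-1.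

Definition associated_set a : set nat :=
  [set m | exists k r, 1 <= r < ratio a k.+1 /\ m = r * a k].

(* d(1) < d(2) < ... lists exactly the elements of S. *)
Definition increasing_enumeration d S : Prop :=
  {in posnat &, {homo d : m n / m < n}} /\ d @` posnat = S.

Definition associated_sequence a d : Prop :=
  increasing_enumeration d (associated_set a).

(* n_k; lemma associated_breakpoint shows d(n_k) = a_k. *)
Fixpoint breakpoint a (k : nat) : nat :=
  if k is k'.+1 then breakpoint a k' + (ratio a k'.+1 - 1) else 1.

Definition lifting a A : set nat :=
  \bigcup_(k in A) [set m | breakpoint a k.-1 <= m <= breakpoint a k - 1].

Definition strongly_non_dli (R : realType) a : Prop :=
  forall A, A `<=` posnat -> infinite_set A ->
    (0 < upper_density R (lifting a A))%E.

Lemma arithmetic_gt0 a k : arithmetic_sequence a -> 0 < a k.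
Proof.
by case=> a0 alt _; elim: k => [|k IH]; rewrite ?a0// (leq_trans _ (alt k)).
Qed.

Lemma ratioK a k : arithmetic_sequence a -> ratio a k.+1 * a k = a k.+1.
Proof. by case=> _ _ adv; exact: divnK. Qed.

Lemma ratio_gt1 a k : arithmetic_sequence a -> 1 < ratio a k.+1.
Proof.
move=> aa; have /(_ k) := let: And3 _ alt _ := aa in alt.
by rewrite -ratioK// -{1}[a k]mul1n ltn_mul2r arithmetic_gt0.
Qed.

Lemma breakpoint_gt0 a k : 0 < breakpoint a k.
Proof. by elim: k => //= k IH; rewrite addn_gt0 IH. Qed.

Lemma increasing_enumeration_next d S n p : increasing_enumeration d S ->
  0 < n -> S p -> d n < p -> (forall q, S q -> d n < q -> p <= q) ->
  d n.+1 = p.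
Proof.
move=> [dlt dS] n0 + dnp pmin; rewrite -dS => -[i i0 dip].
have [in1|ni] := leqP i n.
  suff : d i <= d n by rewrite dip leqNgt dnp.
  move: in1; rewrite leq_eqVlt => /orP[/eqP->//|/dlt]; rewrite !inE => dlt'.
  by apply: ltnW; exact: dlt'.
have ple : p <= d n.+1.
  apply: pmin; first by rewrite -dS; exists n.+1.
  by apply: dlt; rewrite ?inE.
apply/eqP; rewrite eqn_leq ple andbT -dip.
move: ni; rewrite leq_eqVlt => /orP[/eqP->//|/dlt]; rewrite !inE => dlt'.
by apply: ltnW; exact: dlt'.
Qed.

Lemma increasing_enumeration_first d S p : increasing_enumeration d S ->
  S p -> (forall q, S q -> p <= q) -> d 1 = p.
Proof.
move=> [dlt dS] + pmin; rewrite -dS => -[i i0 dip].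
apply/eqP; rewrite eqn_leq pmin ?andbT -?dS; last by exists 1.
rewrite -dip; move: i0; rewrite /posnat /= leq_eqVlt => /orP[/eqP<-//|i1].
by apply/ltnW/dlt; rewrite ?inE// /posnat/= (ltn_trans _ i1).
Qed.

Lemma associated_next a k r q : arithmetic_sequence a ->
  associated_set a q -> r * a k < q -> r.+1 <= ratio a k.+1 ->
  0 < r -> r.+1 * a k <= q.
Proof.
move=> aa [i [s [/andP[s1 sb] ->]]] lt rb r0.
have [ki|ik] := leqP k i.
  have /dvdnP[c ac] : a k %| a i.
    elim: i ki {sb lt} => [|i IH]; first by rewrite leqn0 => /eqP->.
    rewrite leq_eqVlt => /orP[/eqP->//|/IH ki].
    by apply: (dvdn_trans ki); case: aa.
  move: lt; rewrite ac mulnA ltn_mul2r => /andP[ak lt].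
  by rewrite leq_mul2r lt orbT.
have aik : a i.+1 <= a k.
  elim: k ik {lt rb} => // k IH; rewrite ltnS leq_eqVlt => /orP[/eqP->//|/IH h].
  by apply: (leq_trans h); apply: ltnW; case: aa.
have : s * a i < a k.
  apply: leq_trans aik; rewrite -ratioK//.
  by rewrite ltn_mul2r arithmetic_gt0.
move=> /(ltn_trans lt); rewrite ltnNge -{1}[a k]mul1n.
by rewrite leq_mul2r r0 orbT.
Qed.

Lemma associated_sequenceE a d : arithmetic_sequence a ->
  associated_sequence a d -> forall k r, 1 <= r < ratio a k.+1 ->
  d (breakpoint a k + r - 1) = r * a k.
Proof.
move=> aa dP; have b2 k := ratio_gt1 k aa.
have inS k r : 1 <= r < ratio a k.+1 -> associated_set a (r * a k).
  by exists k, r.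
have block k : d (breakpoint a k) = a k -> forall r, 1 <= r < ratio a k.+1 ->
    d (breakpoint a k + r - 1) = r * a k.
  move=> dk; elim=> // -[|r] IH rb; first by rewrite addnK dk mul1n.
  have rb' : r.+1 < ratio a k.+1 by case/andP: rb => _ /ltnW.
  have {}IH : d (breakpoint a k + r) = r.+1 * a k.
    by rewrite -IH//; congr d; lia.
  have -> : breakpoint a k + r.+2 - 1 = (breakpoint a k + r).+1 by lia.
  apply: (increasing_enumeration_next dP).
  - by rewrite addn_gt0 breakpoint_gt0.
  - exact: inS.
  - by rewrite IH ltn_mul2r arithmetic_gt0/=.
  - by move=> q Sq; rewrite IH => lt; apply: associated_next Sq lt _ _.
suff brk k : d (breakpoint a k) = a k by move=> k; exact: block.
elim: k => [|k IH] /=.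
  have a0 : a 0 = 1 by case: aa.
  rewrite a0; apply: (increasing_enumeration_first dP).
    by exists 0, 1; rewrite a0 b2.
  move=> q [k [r [/andP[r1 _] ->]]].
  by rewrite muln_gt0 r1 arithmetic_gt0.
have bk := b2 k.
have dl : d (breakpoint a k + (ratio a k.+1).-1 - 1) = (ratio a k.+1).-1 * a k.
  by apply: block => //; rewrite -ltnS prednK ?leqnn ?andbT// (ltn_trans _ bk).
have -> : breakpoint a k + (ratio a k.+1 - 1) =
    (breakpoint a k + (ratio a k.+1).-1 - 1).+1.
  by have := breakpoint_gt0 a k; lia.
apply: (increasing_enumeration_next dP).
- by have := breakpoint_gt0 a k; lia.
- by rewrite -[a k.+1]mul1n; apply: inS; rewrite b2.
- by rewrite dl -(ratioK k aa) ltn_mul2r arithmetic_gt0//=; lia.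
- move=> q Sq; rewrite dl => lt; rewrite -(ratioK k aa).
  have -> : ratio a k.+1 = (ratio a k.+1).-1.+1 by lia.
  by apply: (associated_next aa Sq lt); lia.
Qed.

Lemma associated_breakpoint a d k : arithmetic_sequence a ->
  associated_sequence a d -> d (breakpoint a k) = a k.
Proof.
move=> aa dP; have := @associated_sequenceE a d aa dP k 1.
by rewrite addnK mul1n ratio_gt1// => ->.
Qed.

End ArithmeticSequences.

Section Circle.
Variable R : realType.

Definition integers : zmodClosed R :=
  GRing.ZmodClosed.clone R (@Num.int_num_subdef R) _.

(* R/Z with the quotient group structure; it then receives the quotient
   topology. The library's alias quotient_topology is not used because it
   carries another eqType structure than the quotient group. *)
Definition circle : Type := Quotient.quot integers.

HB.instance Definition _ := Choice.on circle.
HB.instance Definition _ := EqQuotient.on circle.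
HB.instance Definition _ := GRing.Zmodule.on circle.
HB.instance Definition _ := GRing.isZmodMorphism.Build R circle
  \pi_(circle)%qT (@pi_is_zmod_morphism _ _ _ (Quotient.quot integers)).

Definition circle_open (U : set circle) : Prop :=
  open ((\pi_(circle)%qT : R -> circle) @^-1` U).

Fact circle_openT : circle_open setT.
Proof. by rewrite /circle_open preimage_setT; exact: openT. Qed.

Fact circle_openI (U V : set circle) :
  circle_open U -> circle_open V -> circle_open (U `&` V).
Proof. exact: openI. Qed.

Fact circle_open_bigcup (I : Type) (f : I -> set circle) :
  (forall i, circle_open (f i)) -> circle_open (\bigcup_i f i).
Proof. by move=> of_; apply: bigcup_open => i _; exact: of_. Qed.

HB.instance Definition _ := @isOpenTopological.Build circle circle_open
  circle_openT circle_openI circle_open_bigcup.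

Lemma eq_circle (x y : R) :
  (\pi_(circle)%qT x == \pi_(circle)%qT y) = (x - y \is a Num.int).
Proof. exact: (esym (Quotient.idealrBE integers x y)). Qed.

(* The choice of representative is immaterial, see circle_norm_pi. *)
Definition circle_norm (y : circle) : R :=
  inf [set `|repr y - m%:~R| | m in [set: int]].

Lemma circle_norm_pi (x : R) :
  circle_norm (\pi_(circle)%qT x) = inf [set `|x - m%:~R| | m in [set: int]].
Proof.
have : repr (\pi_(circle)%qT x) - x \is a Num.int by rewrite -eq_circle reprK.
move=> /intrP[c cE]; rewrite /circle_norm; congr inf.
apply/seteqP; split=> _ [m _ <-] /=.
  exists (m - c) => //; rewrite intrB -cE; congr (`| _ |); ring.
exists (m + c) => //; rewrite intrD -cE; congr (`| _ |); ring.
Qed.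

Lemma pi_mulrz (x : R) m :
  \pi_(circle)%qT (x *~ m) = \pi_(circle)%qT x *~ m.
Proof. exact: raddfMz. Qed.


Lemma circle_norm_lt (x e : R) :
  (circle_norm (\pi_(circle)%qT x) < e) <-> exists m : int, `|x - m%:~R| < e.
Proof.
rewrite circle_norm_pi; split.
  move=> h; have [] := inf_lt _ h; last by move=> _ [m _ <-] lt; exists m.
  by exists `|x - 0%:~R|, 0.
move=> [m]; apply: le_lt_trans; apply: ge_inf; last by exists m.
by exists 0 => _ [i _ <-].
Qed.

Lemma cvg_circle0 (f : nat -> circle) :
  f @ \oo --> (0 : circle) <-> (fun n => circle_norm (f n)) @ \oo --> (0 : R).
Proof.
have cn0 (y : circle) : 0 <= circle_norm y.
  apply: lb_le_inf; first by exists `|repr y - 0%:~R|, 0.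
  by move=> _ [m _ <-].
have p0 : \pi_(circle)%qT 0 = 0 by exact: raddf0.
split.
  move=> f0; apply/cvgrPdist_lt => e e0.
  have : nbhs (0 : circle) [set y | circle_norm y < e].
    apply: open_nbhs_nbhs; split.
      rewrite (_ : open _ = circle_open [set y : circle | circle_norm y < e])//.
      rewrite /circle_open (_ : _ @^-1` _ = \bigcup_m ball (m%:~R : R) e).
        apply: (@bigcup_open R int setT) => m _; apply: ball_open; exact: e0.
      apply/seteqP; split=> x /=.
        by move=> /(circle_norm_lt x e) [m lt]; exists m => //; rewrite /ball/= distrC.
      move=> [m _] bm; have lt : `|x - m%:~R| < e by rewrite distrC; exact: bm.
      by apply/(circle_norm_lt x e); exists m.
    have n0 : circle_norm (\pi_(circle)%qT 0) < e.
      by apply/circle_norm_lt; exists 0; rewrite subr0 normr0.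
    by rewrite p0 in n0.
  move=> /f0 H; have {}H : \forall n \near \oo, circle_norm (f n) < e := H.
  by apply: filterS H => n /=; rewrite sub0r normrN ger0_norm.
move=> /cvgrPdist_lt f0 U; rewrite nbhsE => -[V [oV V0] VU].
have : open_nbhs (0 : R) (\pi_(circle)%qT @^-1` V).
  split; first exact: oV.
  by move: V0; rewrite -[X in V X]p0.
move/open_nbhs_nbhs/nbhs_ballP => [e /= e0 eV].
have H := f0 _ e0; apply: filterS H => n /=; rewrite sub0r normrN ger0_norm//.
rewrite -[f n]reprK => /circle_norm_lt [m lt]; apply: VU.
have := eV (repr (f n) - m%:~R); rewrite /ball/= sub0r normrN => /(_ lt).
have -> : \pi_(circle)%qT (repr (f n) - m%:~R) = f n.
  by rewrite -[RHS]reprK; apply/eqP; rewrite eq_circle addrAC subrr sub0r rpredN intr_int.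
by rewrite reprK.
Qed.

Definition converges_to_zero (u : nat -> int) : set circle :=
  [set x : circle | (fun n => x *~ u n) @ \oo --> (0 : circle)].

Definition statistically_converges_to_zero (u : nat -> int) : set circle :=
  [set x : circle | forall e : R, 0 < e ->
     has_density [set n | posnat n /\ e <= circle_norm (x *~ u n)] (0 : \bar R)%E].

End Circle.

(* Main.v *)
(* Suppose e <= |d_n x| infinitely often, and let A be the infinite set of
   blocks [n_{k-1}, n_k - 1] containing such an n.  Inside a block the values
   are multiples r y of the single point y = a_{k-1} x, so if |s y| >= e then,
   by the triangle inequality, one of r and |s - r| always satisfies
   |. y| >= e/2; hence at least a quarter of the block does.  Therefore L(A),
   of positive upper density, has at most four times the upper density of
   {n : |d_n x| >= e/2}, which is 0 under statistical convergence. *)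
Require Import Defs.
From HB Require Import structures.
From mathcomp Require Import all_boot all_order all_algebra.
From mathcomp Require Import zify lra.
From mathcomp Require Import all_classical all_reals all_analysis.

Set Implicit Arguments.
Unset Strict Implicit.
Unset Printing Implicit Defensive.

Import Order.TTheory GRing.Theory Num.Theory.
Import numFieldNormedType.Exports.

Local Open Scope classical_set_scope.
Local Open Scope ring_scope.

(** * Counting elements below a bound *)

Section Counting.
Local Open Scope nat_scope.

(** The numerator of [frequency], as a sum over an interval so that it splits at block ends. *)
Definition count_below (A : set nat) (n : nat) : nat :=
  \sum_(0 <= i < n) (i \in A).

Lemma count_below_cat A m n : m <= n ->
  count_below A n = count_below A m + \sum_(m <= i < n) (i \in A).
Proof. by move=> mn; rewrite /count_below (big_cat_nat (leq0n m) mn). Qed.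

Lemma leq_count_below A m n : m <= n -> count_below A m <= count_below A n.
Proof. by move=> /(count_below_cat A)->; exact: leq_addr. Qed.

Lemma count_below_le A n : count_below A n <= n.
Proof.
rewrite -[leqRHS]subn0 -[leqRHS]muln1 -sum_nat_const_nat.
by apply: leq_sum => i _; exact: leq_b1.
Qed.

(* Reflecting about s pairs up the indices below s, and translating by s pairs
   up those above; each pair contains an index satisfying P. *)
Lemma quarter_le_count (P : pred nat) m s : 0 < s <= m -> P s ->
  (forall r, 0 < r < s -> P r || P (s - r)) ->
  (forall r, s < r <= m -> P r || P (r - s)) ->
  m <= 4 * \sum_(1 <= r < m.+1) P r.
Proof.
move=> /andP[s0 sm] Ps below above.
have lo : s - 1 <= 2 * \sum_(1 <= r < s) P r.
  rewrite mul2n -addnn {2}big_nat_rev /= -big_split /=.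
  rewrite -[leqLHS]muln1 -sum_nat_const_nat.
  rewrite big_nat [leqRHS]big_nat; apply: leq_sum => r rs.
  by have := below r rs; rewrite add1n subSS; case: (P r); case: (P _).
have hi : m - s <= \sum_(s.+1 <= r < m.+1) P r + \sum_(1 <= r < m.+1) P r.
  have -> : m - s = \sum_(s.+1 <= r < m.+1) 1.
    by rewrite sum_nat_const_nat muln1 subSS.
  apply: (@leq_trans (\sum_(s.+1 <= r < m.+1) (P r + P (r - s)))).
    rewrite big_nat [leqRHS]big_nat; apply: leq_sum => r rs.
    by have := above r rs; case: (P r); case: (P _).
  (* The translated indices [r - s] run over 1, ..., [m - s], an initial part of the full range. *)
  rewrite big_split leq_add2l /= -[s.+1]add1n big_addn.
  under eq_bigr do rewrite addnK.
  by rewrite [leqRHS](@big_cat_nat _ _ _ (m.+1 - s)) ?leq_addr//=; lia.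
have tot : \sum_(1 <= r < m.+1) P r =
    \sum_(1 <= r < s) P r + (1 + \sum_(s.+1 <= r < m.+1) P r).
  by rewrite (big_cat_nat s0 (leqW sm)) (@big_ltn _ _ _ s)//= Ps.
(* Add [lo], [hi] and 1 for [s] itself. *)
lia.
Qed.

End Counting.

(** * Blocks between breakpoints, and the lifting *)

Section Blocks.
Local Open Scope nat_scope.
Variable a : nat -> nat.
Hypothesis aa : arithmetic_sequence a.

Lemma breakpoint_ltS k : breakpoint a k < breakpoint a k.+1.
Proof. by rewrite /= -{1}[breakpoint a k]addn0 ltn_add2l subn_gt0 ratio_gt1. Qed.

Lemma breakpoint_le : {mono breakpoint a : j k / j <= k}.
Proof. exact: leq_mono (homo_ltn ltn_trans breakpoint_ltS). Qed.

Lemma breakpoint_lt : {mono breakpoint a : j k / j < k}.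
Proof. exact: leqW_mono breakpoint_le. Qed.

Lemma breakpoint_block n : 0 < n ->
  exists k, breakpoint a k <= n < breakpoint a k.+1.
Proof.
elim: n => // -[|n] IH _; first by exists 0; rewrite (breakpoint_ltS 0).
have [//|k /andP[kn nk]] := IH.
have [nk'|nk'] := ltnP n.+2 (breakpoint a k.+1).
  by exists k; rewrite nk' (leq_trans kn).
by exists k.+1; rewrite nk' (leq_ltn_trans nk)// breakpoint_ltS.
Qed.

(** Blocks are disjoint; the one starting at [breakpoint a k] is attached by [lifting] to [k.+1]. *)
Lemma lifting_block A k i : breakpoint a k <= i < breakpoint a k.+1 ->
  (i \in lifting a A) = (k.+1 \in A).
Proof.
move=> /andP[ki ik]; apply/idP/idP; rewrite !inE; last first.
  by move=> Ak; exists k.+1 => //=; rewrite ki; move: ik => /=; lia.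
move=> [j Aj /= /andP[ji ij]].
have {}ij : i < breakpoint a j by have := breakpoint_gt0 a j; lia.
have kj : k < j by rewrite -breakpoint_lt (leq_ltn_trans ki).
have jk : j.-1 < k.+1 by rewrite -breakpoint_lt (leq_ltn_trans ji).
by have <- : j = k.+1 by lia.
Qed.

Lemma sum_lifting_block A k n : breakpoint a k <= n <= breakpoint a k.+1 ->
  \sum_(breakpoint a k <= i < n) (i \in lifting a A) =
  (k.+1 \in A) * (n - breakpoint a k).
Proof.
move=> /andP[kn nk]; rewrite mulnC -sum_nat_const_nat.
rewrite big_nat [RHS]big_nat; apply: eq_bigr => i /andP[ki ik].
by rewrite (@lifting_block A k)// ki (leq_trans ik).
Qed.

(** Later [A] marks the blocks containing a value of norm at least [e], and [G] the indices whose
    value has norm at least [e / 2]. *)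
Variables A G : set nat.
Hypothesis AG : forall k, k.+1 \in A ->
  breakpoint a k.+1 - breakpoint a k <=
  4 * \sum_(breakpoint a k <= i < breakpoint a k.+1) (i \in G).

Lemma count_lifting_breakpoint k :
  count_below (lifting a A) (breakpoint a k) <=
  4 * count_below G (breakpoint a k).
Proof.
elim: k => [|k IH].
  (* Only the index 0 lies below the first breakpoint, and no block contains it. *)
  rewrite /count_below /= !big_nat1 memNset//.
  by move=> [j _ /= /andP[]]; rewrite leqNgt breakpoint_gt0.
have kk := ltnW (breakpoint_ltS k).
rewrite !(count_below_cat _ kk) mulnDr leq_add// sum_lifting_block ?kk ?leqnn//.
by case: (boolP (k.+1 \in A)) => [/AG|]; rewrite ?mul1n// mul0n.
Qed.

(* Completing the block that contains n, when it belongs to the lifting, can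
   only increase the frequency. *)
Lemma count_lifting_complete n : 0 < n -> exists2 N, n <= N &
  count_below (lifting a A) n * N <= 4 * count_below G N * n.
Proof.
move=> n0; have [k /andP[kn nk]] := breakpoint_block n0.
have kk := ltnW nk.
have [Ak|Ak] := boolP (k.+1 \in A); last first.
  (* An unmarked block adds nothing to the lifting, so [N = n] works. *)
  exists n => //; rewrite leq_mul2r (count_below_cat _ kn); apply/orP; right.
  rewrite sum_lifting_block ?kn// (negbTE Ak) addn0.
  apply: leq_trans (count_lifting_breakpoint k) _.
  by rewrite leq_mul2l leq_count_below.
exists (breakpoint a k.+1) => //.
apply: (@leq_trans (count_below (lifting a A) (breakpoint a k.+1) * n)); last first.
  by rewrite leq_mul2r count_lifting_breakpoint orbT.
have e1 : count_below (lifting a A) (breakpoint a k.+1) =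
    count_below (lifting a A) n + (breakpoint a k.+1 - n).
  rewrite (count_below_cat _ (leq_trans kn kk)) (count_below_cat _ kn).
  rewrite !sum_lifting_block ?leqnn ?(leq_trans kn kk) ?kn// Ak !mul1n.
  by move: (breakpoint a k.+1) kk => N nN; lia.
rewrite e1; have := count_below_le (lifting a A) n.
move: (count_below _ n) (breakpoint a k.+1) kk => c N nN cn.
(* With [N = n + (N - n)], the inequality c/n <= (c + N - n)/N reduces to [c <= n]. *)
rewrite -[in leqLHS](subnKC nN) mulnDr mulnDl leq_add2l mulnC leq_mul2l cn.
by rewrite orbT.
Qed.

End Blocks.

(** * Upper limits and densities *)

Section Densities.
Variable R : realType.
Implicit Types (u : nat -> \bar R) (A : set nat).

Lemma frequencyE A n :
  frequency R A n = ((count_below A n)%:R / n%:R)%:E.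
Proof.
rewrite /frequency /count_below big_mkord -sum1_card big_mkcond /=.
by congr ((_%:R / _)%:E); apply: eq_bigr => i _; rewrite inE; case: ifP.
Qed.

Lemma limn_esup_le u c : (\forall n \near \oo, u n <= c)%E ->
  (limn_esup u <= c)%E.
Proof.
(* [limn_esup] is an infimum of suprema over eventual sets; this set is one of them. *)
move=> uc; apply: (@le_trans _ _ (ereal_sup (u @` [set n | u n <= c]%E))).
  by apply: ereal_inf_lbound; exists [set n | u n <= c]%E.
by apply: ge_ereal_sup => _ [n ? <-].
Qed.

Lemma limn_esup_lt_near u c : (limn_esup u < c)%E ->
  \forall n \near \oo, (u n < c)%E.
Proof.
move=> /ereal_inf_lt[_ [B FB <-] Bc].
apply: filterS FB => n Bn; apply: le_lt_trans Bc.
by apply: ereal_sup_ubound; exists n.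
Qed.

Lemma has_density0_bounded A N : (forall n, A n -> (n < N)%N) ->
  has_density A (0 : \bar R)%E.
Proof.
move=> AN; suff : frequency R A @ \oo --> (0 : \bar R)%E.
  by move=> /cvg_limn_einf_sup[ei es]; split.
apply: limn_esup_le_cvg => [|n]; last by rewrite frequencyE lee_fin divr_ge0.
apply/lee_addgt0Pr => e e0; rewrite add0e; apply: limn_esup_le.
(* From this index on N/n <= e, while at most [N] elements are counted. *)
exists (Num.truncn (N%:R / e)).+1 => // n /= Nn.
have n0 : (0 < n)%N by exact: leq_trans Nn.
rewrite frequencyE lee_fin ler_pdivrMr ?ltr0n// mulrC -ler_pdivrMr//.
apply: (@le_trans _ _ (N%:R / e)).
  rewrite ler_pM2r ?invr_gt0// ler_nat.
  have [nN|Nn'] := leqP n N; first exact: leq_trans (count_below_le A n) nN.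
  rewrite (count_below_cat A (ltnW Nn')) big_nat big1 ?addn0 ?count_below_le//.
  by move=> i /andP[Ni _]; rewrite memNset// => /AN; rewrite ltnNge Ni.
by apply/ltW/(lt_le_trans (truncnS_gt _)); rewrite ler_nat.
Qed.


(** The frequency of [A] at [n] is at most [C] times that of [G] at some [N >= n], where it is
    eventually below [e / C]. *)
Lemma upper_density_le A G (C : R) : 0 < C ->
  (forall n, (0 < n)%N -> exists2 N, (n <= N)%N &
    (count_below A n * N)%:R <= C * (count_below G N * n)%:R) ->
  (upper_density R G <= 0)%E -> (upper_density R A <= 0)%E.
Proof.
move=> C0 AG G0; apply/lee_addgt0Pr => e e0; rewrite add0e.
have : (upper_density R G < (e / C)%:E)%E.
  by apply: le_lt_trans G0 _; rewrite lte_fin divr_gt0.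
move=> /limn_esup_lt_near [M _ HM]; apply: limn_esup_le.
exists M.+1 => // n /= Mn; have n0 : (0 < n)%N by exact: leq_trans Mn.
have [N nN le] := AG _ n0.
have := HM N; rewrite /= !frequencyE lte_fin lee_fin => /(_ _)/wrap[].
  by rewrite (leq_trans _ nN)// ltnW.
have N0 : (0 < N)%N by exact: leq_trans nN.
move: le; rewrite !natrM.
rewrite -(ltr0n R) in n0; rewrite -(ltr0n R) in N0.
rewrite ltr_pdivrMr// ler_pdivrMr// => le lt.
rewrite -(ler_pM2r N0) (le_trans le)// mulrA [leRHS]mulrAC.
rewrite ler_pM2r// -ler_pdivlMl// mulrA [C^-1 * _]mulrC; exact: ltW.
Qed.

End Densities.

(** * The norm on the circle *)

Section CircleNorm.
Variable R : realType.
Implicit Types (y z : circle R) (e : R).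

Lemma circle_norm_ge0 y : 0 <= circle_norm y.
Proof.
rewrite leNgt; apply/negP; rewrite -[y]reprK => /circle_norm_lt[m].
by rewrite normr_lt0.
Qed.

Lemma circle_normN y : circle_norm (- y) = circle_norm y.
Proof.
have H e z : circle_norm z < e -> circle_norm (- z) < e.
  rewrite -[z]reprK -raddfN => /circle_norm_lt[m lt].
  apply/circle_norm_lt; exists (- m).
  by rewrite rmorphN /= -opprD normrN.
by apply/eqP; rewrite eq_le; apply/andP; split; rewrite leNgt; apply/negP => /H;
  rewrite ?opprK ltxx.
Qed.

Lemma circle_norm_ltD y z e e' : circle_norm y < e -> circle_norm z < e' ->
  circle_norm (y + z) < e + e'.
Proof.
rewrite -[y]reprK -[z]reprK -raddfD => /circle_norm_lt[m my] /circle_norm_lt[n nz].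
apply/circle_norm_lt; exists (m + n); rewrite rmorphD /= opprD addrACA.
by rewrite (le_lt_trans (ler_normD _ _))// ltrD.
Qed.

Lemma circle_norm_half y z e : e <= circle_norm (y + z) ->
  (e / 2 <= circle_norm y) || (e / 2 <= circle_norm z).
Proof.
apply: contraTT; rewrite negb_or -!ltNge => /andP[ye ze].
by have := circle_norm_ltD ye ze; rewrite -splitr.
Qed.

(** Use sy = ry + (s - r)y for r < s, and sy = ry - (r - s)y for r > s. *)
Lemma quarter_multiples_far y e m s : (0 < s <= m)%N ->
  0 < e -> e <= circle_norm (y *+ s) ->
  (m <= 4 * \sum_(1 <= r < m.+1) (e / 2 <= circle_norm (y *+ r))%R)%N.
Proof.
move=> sm e0 es; apply: (quarter_le_count sm).
- by apply: le_trans es; lra.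
- move=> r /andP[r0 rs]; apply: circle_norm_half.
  by rewrite -mulrnDr subnKC// ltnW.
- move=> r /andP[sr rm]; rewrite -[circle_norm (y *+ (r - s))]circle_normN.
  by apply: circle_norm_half; rewrite -mulrnBr ?leq_subr// subKn// ltnW.
Qed.

End CircleNorm.

(** Convergence leaves only a bounded set of indices with norm at least [e]. *)
Lemma converges_statistically (R : realType) (u : nat -> int) :
  @converges_to_zero R u `<=` @statistically_converges_to_zero R u.
Proof.
move=> x /cvg_circle0/cvgrPdist_lt H e /H [N _ HN].
apply: (@has_density0_bounded R _ N) => n [_ en]; rewrite ltnNge; apply/negP.
move=> /HN /=; rewrite sub0r normrN => /(le_lt_trans (ler_norm _)).
by rewrite ltNge en.
Qed.

Theorem theorem3p17 (R : realType) (a d : nat -> nat)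
    (ha : arithmetic_sequence a) (hd : associated_sequence a d)
    (hdli : strongly_non_dli R a) :
  @statistically_converges_to_zero R (fun n => Posz (d n)) =
  @converges_to_zero R (fun n => Posz (d n)).
Proof.
apply/seteqP; split; last exact: converges_statistically.
move=> x xs; apply/cvg_circle0/cvgrPdist_lt => e e0.
pose A := [set k | posnat k /\ exists2 n, (breakpoint a k.-1 <= n < breakpoint a k)%N
  & e <= circle_norm (x *~ d n)].
have [/finite_seqP[s As]|Ainf] := pselect (finite_set A).
  (* Past the end of the last marked block every norm is below [e]. *)
  exists (breakpoint a (\max_(k <- s) k)) => // n /= sn.
  rewrite sub0r normrN ger0_norm ?circle_norm_ge0// ltNge; apply/negP => en.
  have [|k /andP[kn nk]] := breakpoint_block ha (n := n).
    exact: leq_trans (breakpoint_gt0 _ _) sn.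
  have : A k.+1 by split=> //; exists n; rewrite ?kn.
  rewrite As /= => ks.
  by move: nk; rewrite ltnNge (leq_trans _ sn)// breakpoint_le// leq_bigmax_seq.
pose G := [set n | posnat n /\ e / 2 <= circle_norm (x *~ d n)].
suff AG k : k.+1 \in A -> (breakpoint a k.+1 - breakpoint a k <=
    4 * \sum_(breakpoint a k <= i < breakpoint a k.+1) (i \in G))%N.
  have : (0 < upper_density R (lifting a A))%E by apply: hdli => // k [].
  rewrite ltNge => /negP[].
  have [G0 _] : has_density G (0 : \bar R)%E by apply: xs; rewrite divr_gt0.
  apply: (@upper_density_le R (lifting a A) G 4) => // [n n0|].
    have [N nN le] := count_lifting_complete ha AG n0.
    by exists N => //; rewrite -natrM ler_nat mulnA.
  by rewrite G0.
rewrite inE => -[_ [n]]; rewrite [k.+1.-1]/= => /andP[kn nk] en.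
set m := (_ - breakpoint a k)%N.
(* Position [r] of the block, counted from 1, carries the multiple [r] of the single point
   [x *+ a k]. *)
have dE r : (0 < r <= m)%N ->
    circle_norm (x *~ d (breakpoint a k + r - 1)%N) = circle_norm (x *+ a k *+ r).
  move=> rm; rewrite (associated_sequenceE ha hd); last by move: rm; rewrite /m /=; lia.
  by rewrite -pmulrn mulnC mulrnA.
have nE : n = (breakpoint a k + (n - breakpoint a k).+1 - 1)%N by lia.
have sm : (0 < (n - breakpoint a k).+1 <= m)%N by rewrite /m; lia.
rewrite nE dE// in en.
apply: leq_trans (quarter_multiples_far sm e0 en) _.
(* Both sums are reindexed from 0: the multiple j + 1 sits at index [breakpoint a k] + j. *)
rewrite leq_mul2l /= big_add1 /= -[X in (_ <= \sum_(X <= _ < _) _)%N]add0n big_addn.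
rewrite -/m big_nat [leqRHS]big_nat; apply: leq_sum => r rm.
rewrite -dE//; case: (boolP (_ <= _)) => // er.
rewrite mem_set//; split; first by rewrite /posnat /= addn_gt0 breakpoint_gt0 orbT.
by move: er; congr (_ <= circle_norm (x *~ Posz (d _))); lia.
Qed.
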